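(* Let $n,k$ be positive integers and let $G$ be a group of order $2n$ with exactly $2k-1$ involutions. Let $\overline{U}$ be the set consisting of the identity and all involutions of $G$. Then the following are equivalent. (i) The group $G$ is $nK_2$-optimal. (ii) The power graph $\Gamma_G$ has a perfect matching. (iii) There exist $k$ pairwise vertex-disjoint, inverse-closed paths $P_1,\ldots,P_k$ in $\Gamma_G$ such that $$\bigcup_{i=1}^k L(P_i)=\overline{U}.$$
   Context: Graphs are finite, simple and undirected. The power graph $\Gamma_G$ of a group $G$ has vertex set $G$, and two distinct elements are adjacent if one is a power of the other. An embedding of a graph $\Gamma_1$ into a graph $\Gamma_2$ is an injection $f:V(\Gamma_1)\to V(\Gamma_2)$ such that $\{x,y\}\in E(\Gamma_1)$ implies $\{f(x),f(y)\}\in E(\Gamma_2)$ (the image need not be an induced subgraph). The power index $\Theta(\Gamma)$ of a graph $\Gamma$ is the least order of a group $G$ such that $\Gamma$ embeds into $\Gamma_G$. A group $G$ is $\Gamma$-optimal if $\Gamma$ embeds into $\Gamma_G$ and $|G|=\Theta(\Gamma)$. The graph $nK_2$ (the $1$-factor) is the disjoint union of $n$ copies of $K_2$. A perfect matching of a graph $\Gamma$ is a set of pairwise nonadjacent (i.e. vertex-disjoint) edges of size $|V(\Gamma)|/2$. An involution is an element of order $2$. A path has pairwise distinct vertices; a path $P$ in $\Gamma_G$ is inverse-closed if $V(P)=\{x^{-1}:x\in V(P)\}$, and $L(P)$ denotes the set of endpoints of $P$. *)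

(* Defs.v *)
From mathcomp Require Import all_boot all_fingroup.

Set Implicit Arguments.
Unset Strict Implicit.
Unset Printing Implicit Defensive.

Local Open Scope group_scope.

Record sgraph := SGraph {
  vertex :> finType;
  adj : rel vertex;
  adj_sym : symmetric adj;
  adj_irrefl : irreflexive adj }.

Definition edges (Gamma : sgraph) : {set {set Gamma}} :=
  [set [set u.1; u.2] | u : Gamma * Gamma & adj u.1 u.2].

(* The image need not be an induced subgraph. *)
Definition is_embedding (Gamma1 Gamma2 : sgraph) (f : Gamma1 -> Gamma2) : Prop :=
  injective f /\ (forall x y, adj x y -> adj (f x) (f y)).

Definition embeds (Gamma1 Gamma2 : sgraph) : Prop :=
  exists f : Gamma1 -> Gamma2, is_embedding f.

Definition is_perfect_matching (Gamma : sgraph) (M : {set {set Gamma}}) : Prop :=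
  [/\ M \subset edges Gamma, trivIset M & (2 * #|M|)%N = #|Gamma|].

Definition has_perfect_matching (Gamma : sgraph) : Prop :=
  exists M : {set {set Gamma}}, is_perfect_matching M.

(* A path is the list of its vertices in order; one-vertex paths are allowed and
   then have a single endpoint. *)
Definition is_path (Gamma : sgraph) (P : seq Gamma) : bool :=
  [&& P != [::], sorted (@adj Gamma) P & uniq P].

Arguments is_path : clear implicits.

Definition endpoints (T : finType) (P : seq T) : {set T} :=
  if P is x :: p then [set x; last x p] else set0.

Definition nK2_adj (n : nat) : rel ('I_n * bool) :=
  fun u v => (u.1 == v.1) && (u.2 != v.2).

Lemma nK2_sym n : symmetric (@nK2_adj n).
Proof. by move=> u v; rewrite /nK2_adj eq_sym (eq_sym u.2). Qed.

Lemma nK2_irrefl n : irreflexive (@nK2_adj n).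
Proof. by move=> u; rewrite /nK2_adj !eqxx. Qed.

Definition nK2 (n : nat) : sgraph := SGraph (@nK2_sym n) (@nK2_irrefl n).

(* Membership in <[y]> means being a power of y (cycleP). *)
Definition power_adj (gT : finGroupType) : rel gT :=
  fun x y => (x != y) && ((x \in <[y]>) || (y \in <[x]>)).

Lemma power_sym (gT : finGroupType) : symmetric (@power_adj gT).
Proof. by move=> x y; rewrite /power_adj eq_sym orbC. Qed.

Lemma power_irrefl (gT : finGroupType) : irreflexive (@power_adj gT).
Proof. by move=> x; rewrite /power_adj eqxx. Qed.

Definition power_graph (gT : finGroupType) : sgraph :=
  SGraph (@power_sym gT) (@power_irrefl gT).

(* Theta(Gamma) = m, as a relation. *)
Definition is_power_index (Gamma : sgraph) (m : nat) : Prop :=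
  (exists2 hT : finGroupType, embeds Gamma (power_graph hT) & #|hT| = m) /\
  (forall hT : finGroupType, embeds Gamma (power_graph hT) -> m <= #|hT|).

Definition optimal (Gamma : sgraph) (gT : finGroupType) : Prop :=
  embeds Gamma (power_graph gT) /\ is_power_index Gamma #|gT|.

Definition involutions (gT : finGroupType) : {set gT} :=
  [set x : gT | #[x] == 2].

Definition Ubar (gT : finGroupType) : {set gT} := 1 |: involutions gT.

Definition inverse_closed (gT : finGroupType) (P : seq gT) : Prop :=
  [set x in P] = [set x^-1 | x in P].

(* Main.v *)
(* A perfect matching is the same thing as an involution [m] of the vertex set
   with [x] adjacent to [m x]; since [|G| = 2n], it is also the same thing as an
   embedding of [nK2] into the power graph.  Let [s] be inversion, whose fixed
   points are the [2k] elements of [Ubar].  Alternating [m] and [s] from a fixed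
   point [u] of [s] gives a path that ends at another fixed point; its vertices
   form the orbit of [u] under [s \o m], so these paths are disjoint and stable
   under [s].  Conversely, [k] disjoint paths whose endpoints exhaust [Ubar] have
   two endpoints each and no inner vertex in [Ubar]; being inverse-closed they
   have evenly many vertices, hence can be matched along consecutive edges, and
   every vertex outside the paths is matched with its inverse. *)
Require Import Defs.
From mathcomp Require Import all_boot all_fingroup.
From mathcomp Require Import cyclic zify.

Set Implicit Arguments.
Unset Strict Implicit.
Unset Printing Implicit Defensive.

(** * Perfect matchings, embeddings of [nK2] and fixed-point-free involutions *)

Definition matching_involution (Gamma : sgraph) (m : Gamma -> Gamma) : Prop :=
  involutive m /\ forall x, adj x (m x).

(** Each orbit [{x, t x}] has two elements, and [R] keeps the one of smaller rank. This serves both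
    to choose representatives and to show that a cardinal is even. *)
Lemma free_involution_half (T : finType) (A : {set T}) (t : T -> T) :
    {in A, forall x, t x \in A} -> {in A, cancel t t} ->
    {in A, forall x, t x != x} ->
  exists R : {set T},
    [/\ R \subset A, {in R, forall x, t x \notin R},
        {in A, forall x, x \notin R -> t x \in R} & #|A| = 2 * #|R|].
Proof.
move=> tA tK t_free.
pose R := [set x in A | enum_rank x < enum_rank (t x)].
have RA : R \subset A by apply/subsetP=> x /[!inE] /andP[].
have tR : {in R, forall x, t x \notin R}.
  move=> x /[!inE] /andP[Ax lt_x].
  by rewrite tK // negb_and -leqNgt (ltnW lt_x) orbT.
have tnR : {in A, forall x, x \notin R -> t x \in R}.
  move=> x Ax; rewrite !inE Ax tA //= tK // -leqNgt leq_eqVlt.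
  case/orP=> // /eqP/val_inj/enum_rank_inj tx.
  by have := t_free x Ax; rewrite tx eqxx.
clearbody R; exists R; split=> //.
have defA : A = R :|: t @: R.
  apply/setP=> x; rewrite inE; apply/idP/orP=> [Ax|[/(subsetP RA)//|]].
    have [Rx|nRx] := boolP (x \in R); [by left | right].
    by apply/imsetP; exists (t x); rewrite ?tK ?tnR.
  by case/imsetP=> y /(subsetP RA) Ay ->; apply: tA.
have disj : R :&: t @: R = set0.
  apply/setP=> x; rewrite !inE; apply/negbTE/negP=> /andP[Rx /imsetP[y Ry xy]].
  by have := tR y Ry; rewrite -xy Rx.
rewrite defA cardsU disj cards0 subn0 card_in_imset ?mul2n ?addnn //.
by apply: (can_in_inj (g := t)) => x /(subsetP RA); apply: tK.
Qed.

Lemma matching_involutionP (Gamma : sgraph) :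
  has_perfect_matching Gamma <-> exists m : Gamma -> Gamma, matching_involution m.
Proof.
split=> [[M [ME tM cardM]] | [m [mK m_adj]]].
  have Medge E : E \in M -> exists x y, E = [set x; y] /\ adj x y.
    by move/(subsetP ME)/imsetP=> [[x y]]; rewrite inE /= => xy ->; exists x, y.
  have M2 : {in M, forall E : {set Gamma}, #|E| = 2}.
    move=> E /Medge[x [y [-> xy]]]; rewrite cards2; case: eqVneq => // xy'.
    by move: xy; rewrite xy' adj_irrefl.
  (* The members of [M] are disjoint of size 2, so the count [2 * #|M|] forces them to exhaust the
     vertices. *)
  have covM x : x \in cover M.
    suff -> : cover M = setT by rewrite inE.
    apply/eqP; rewrite eqEcard subsetT cardsT -cardM.
    move: tM; rewrite /trivIset => /eqP <-.
    by rewrite (eq_bigr (fun=> 2) M2) sum_nat_const mulnC /=.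
  have ex_y (x : Gamma) : exists y : Gamma, ([set x; y] \in M) && adj x y.
    have /bigcupP[E EM] := covM x.
    case/Medge: (EM) => a [b [defE ab]]; rewrite defE !inE.
    case/orP=> /eqP ->; first by exists b; rewrite -defE EM.
    by exists a; rewrite setUC -defE EM adj_sym.
  pose m x := xchoose (ex_y x).
  have mM x : [set x; m x] \in M by have /andP[] := xchooseP (ex_y x).
  have m_adj x : adj x (m x) by have /andP[] := xchooseP (ex_y x).
  exists m; split=> // x.
  (* Both edges are the block of [M] that contains [m x]. *)
  have eqE : [set x; m x] = [set m x; m (m x)].
    by rewrite -(def_pblock tM (mM x) (set22 _ _)) (def_pblock tM (mM _) (set21 _ _)).
  have : m (m x) \in [set x; m x] by rewrite eqE set22.
  rewrite !inE => /orP[/eqP // | /eqP mmx].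
  by have := m_adj (m x); rewrite mmx adj_irrefl.
pose M := [set [set x; m x] | x : Gamma].
have tM : trivIset M.
  apply/trivIsetP=> _ _ /imsetP[x _ ->] /imsetP[y _ ->].
  apply: contraR => /pred0Pn[z /=]; rewrite !inE.
  case/andP=> /orP[] /eqP -> /orP[] /eqP.
  - by move->.
  - by move->; rewrite mK setUC.
  - by move<-; rewrite mK setUC.
  - by move/(can_inj mK)->.
exists M; split=> //.
  apply/subsetP=> _ /imsetP[x _ ->]; apply/imsetP; exists (x, m x) => //.
  by rewrite inE.
have covM : cover M = setT.
  apply/setP=> x; rewrite inE; apply/bigcupP; exists [set x; m x]; last exact: set21.
  exact: imset_f.
move: tM; rewrite -cardsT -covM /trivIset => /eqP <-.
rewrite (eq_bigr (fun=> 2)) ?sum_nat_const 1?mulnC // => _ /imsetP[x _ ->].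
rewrite cards2; case: eqVneq => // xm.
by have := m_adj x; rewrite -xm adj_irrefl.
Qed.

(** Since [nK2 n] has [2 * n] vertices, every host group has order at least [2 * n]. Hence an
    embedding into [gT] is already optimal, and it is a bijection. *)
Lemma optimal_nK2_matching (n : nat) (gT : finGroupType) : #|gT| = 2 * n ->
  optimal (nK2 n) gT <-> exists m : power_graph gT -> power_graph gT, matching_involution m.
Proof.
move=> hG.
have card_nK2 : #|nK2 n| = 2 * n by rewrite card_prod card_ord card_bool mulnC.
split=> [[[f [f_inj f_adj]] _] | [m [mK m_adj]]].
  have f_onto (x : gT) : x \in codom f by apply: inj_card_onto; rewrite // card_nK2 hG.
  pose flip (u : nK2 n) : nK2 n := (u.1, ~~ u.2).
  exists (fun x => f (flip (iinv (f_onto x)))); split=> x.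
    set u := iinv (f_onto x).
    rewrite (_ : iinv _ = flip u); first by rewrite /flip /= negbK -surjective_pairing f_iinv.
    by apply: f_inj; rewrite f_iinv.
  rewrite -{1}(f_iinv (f_onto x)); apply: f_adj.
  by rewrite /= /nK2_adj /= eqxx; case: (iinv _).2.
have m_free x : m x != x.
  by apply/eqP=> mx; have := m_adj x; rewrite mx adj_irrefl.
have [R [_ tR _]] := @free_involution_half gT setT m (fun x _ => in_setT _)
  (fun x _ => mK x) (fun x _ => m_free x).
rewrite cardsT hG => /eqP; rewrite eqn_mul2l /= => /eqP cardR.
have emb : embeds (nK2 n) (power_graph gT).
  (* [g] enumerates one end of each matching edge; the boolean of a vertex of [nK2 n] chooses
     between that end and its partner. *)
  pose g (i : 'I_n) : gT := enum_val (cast_ord cardR i).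
  have gR i : g i \in R by apply: enum_valP.
  exists (fun u : nK2 n => if u.2 then g u.1 else m (g u.1)); split.
    have g_inj : injective g by move=> i j /enum_val_inj/cast_ord_inj.
    move=> [i []] [j []] //=.
    - by move/g_inj->.
    - by move=> e; have := tR _ (gR j); rewrite -e gR.
    - by move=> e; have := tR _ (gR i); rewrite e gR.
    - by move/(can_inj mK)/g_inj->.
  move=> [i b] [j c]; rewrite /= /nK2_adj /= => /andP[/eqP <-].
  by case: b c => [] [] // _; [|rewrite power_sym]; apply: m_adj.
split=> //; split; first by exists gT.
move=> hT [f [f_inj _]]; rewrite hG -card_nK2.
exact: (leq_card f f_inj).
Qed.

Lemma endpointsE (T : finType) (x0 : T) (P : seq T) : 0 < size P ->
  endpoints P = [set nth x0 P 0; nth x0 P (size P).-1].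
Proof. by case: P => // x p _ /=; rewrite (last_nth x0). Qed.

(** * Orbits of the product of two involutions *)

Section TwoInvolutions.
Local Open Scope group_scope.

Variables (T : finType) (s m : T -> T).
Hypotheses (sK : involutive s) (mK : involutive m) (m_free : forall x, m x != x).

Definition two_involutions_perm : {perm T} :=
  perm (can_inj mK) * perm (can_inj sK).
Local Notation r := two_involutions_perm.
Local Notation d u := #|porbit r u|.

Lemma two_involutions_permE x : r x = s (m x).
Proof. by rewrite permM !permE. Qed.

Let r_d u : (r ^+ d u) u = u. Proof. by rewrite permX iter_porbit. Qed.

Let d_gt0 u : 0 < d u.
Proof. by apply/card_gt0P; exists u; apply: porbit_id. Qed.

Let r_inj u a b : a < d u -> b < d u -> (r ^+ a) u = (r ^+ b) u -> a = b.
Proof.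
move=> lta ltb /eqP; rewrite !permX.
rewrite -(nth_traject r lta) -(nth_traject r ltb).
by rewrite nth_uniq ?size_traject ?uniq_traject_porbit // => /eqP.
Qed.

(* [s] conjugates [r] to its inverse, and [r ^+ d u] fixes [u]. *)
Let s_r u a : s u = u -> a <= d u -> s ((r ^+ a) u) = (r ^+ (d u - a)) u.
Proof.
move=> su le_a.
have s_rr b x : (r ^+ b) (s ((r ^+ b) x)) = s x.
  elim: b => [|b IHb] in x *; first by rewrite expg0 !perm1.
  rewrite {2}expgSr expgS !permM -[RHS]IHb; congr ((r ^+ b) _).
  by rewrite !permE sK mK.
apply: (@perm_inj _ (r ^+ a)).
by rewrite s_rr su -permM -expgD subnK // r_d.
Qed.

(** [m] is [s] after [r], so it reflects exponents as [s] does, with a shift by one. *)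
Let m_r u a : s u = u -> a < d u -> m ((r ^+ a) u) = (r ^+ (d u - a).-1) u.
Proof.
move=> su lt_a; rewrite -[LHS]sK -two_involutions_permE -permM -expgSr s_r //.
by congr ((r ^+ _) u); lia.
Qed.

(** For odd [d u] the reflection of exponents by [m] would fix the middle one, against [m_free]. *)
Let d_even u : s u = u -> ~~ odd (d u).
Proof.
move=> su; apply/negP=> odd_d.
have := m_free ((r ^+ (d u)./2) u); rewrite m_r //; last by have := d_gt0 u; lia.
by rewrite (_ : (d u - _).-1 = (d u)./2) ?eqxx //; lia.
Qed.

(** The point halfway round the orbit; for [u] fixed by [s] it is the other fixed point there. *)
Definition opposite u := (r ^+ (d u)./2) u.

Lemma opposite_fixed u : s u = u -> s (opposite u) = opposite u.
Proof.
move=> su; rewrite /opposite s_r //; last lia.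
by congr ((r ^+ _) u); have := d_even su; lia.
Qed.

Lemma opposite_porbit u : porbit r (opposite u) = porbit r u.
Proof. by apply/eqP; rewrite eq_porbit_mem mem_porbit. Qed.

Lemma oppositeK u : s u = u -> opposite (opposite u) = u.
Proof.
move=> su; rewrite {1}/opposite opposite_porbit /opposite -permM -expgD.
by rewrite addnn even_halfK ?r_d // d_even.
Qed.

Lemma opposite_free u : s u = u -> opposite u != u.
Proof.
move=> su; have d0 := d_gt0 u; have dE := d_even su.
apply/eqP=> opp_u; suff : (d u)./2 = 0 by lia.
by apply: (@r_inj u); rewrite ?expg0 ?perm1 //; lia.
Qed.

(** A fixed point of exponent [a] satisfies [a = d u - a] modulo [d u], so [a] is 0 or half of
    [d u]. *)
Lemma fixed_porbit u v : s u = u -> s v = v -> v \in porbit r u ->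
  v = u \/ v = opposite u.
Proof.
move=> su sv; rewrite porbit_traject => /trajectP[a lt_a].
rewrite -permX => def_v; move: sv; rewrite def_v s_r //; last exact: ltnW.
case: (posnP a) => [-> _|a_gt0]; first by left; rewrite expg0 perm1.
have lt_da : d u - a < d u by lia.
by move/(r_inj lt_da lt_a) => d_a; right; congr ((r ^+ _) u); lia.
Qed.

Lemma porbit_stable u x : s u = u -> x \in porbit r u -> s x \in porbit r u.
Proof.
move=> su; rewrite {1}porbit_traject => /trajectP[a lt_a ->].
by rewrite -permX s_r ?mem_porbit // ltnW.
Qed.

(* The walk [u, m u, s (m u), ...], as exponents of [r]. *)
Definition walk_exp u i := if odd i then d u - i./2.+1 else i./2.

Definition walk u : seq T :=
  mkseq (fun i => (r ^+ walk_exp u i) u) (d u).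

Let walk_exp_lt u i : i < d u -> walk_exp u i < d u.
Proof. rewrite /walk_exp; case: ifP; lia. Qed.

(** Even positions use exponents below half of [d u], odd positions use exponents at or above it,
    and each kind is monotone in the position. *)
Lemma walk_uniq u : uniq (walk u).
Proof.
apply/mkseq_uniqP=> i j; rewrite !inE => lti ltj.
move/(r_inj (walk_exp_lt lti) (walk_exp_lt ltj)).
rewrite /walk_exp; move: lti ltj; do 2 case: ifP; lia.
Qed.

Lemma mem_walk u : walk u =i porbit r u.
Proof.
move=> x; rewrite -(mem_enum (porbit r u)).
have [//||_ ->//] := @uniq_min_size _ (walk u) (enum (porbit r u)) (walk_uniq u).
  by move=> _ /mapP[i _ ->]; rewrite mem_enum mem_porbit.
by rewrite size_mkseq -cardE.
Qed.

Lemma walk_step x0 u i : s u = u -> i.+1 < size (walk u) ->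
  nth x0 (walk u) i.+1 = (if odd i then s else m) (nth x0 (walk u) i).
Proof.
move=> su; rewrite size_mkseq => lti; rewrite !nth_mkseq //; last exact: ltnW.
rewrite /walk_exp /=; case: (boolP (odd i)) => odd_i /=; [rewrite s_r // | rewrite m_r //]; try lia.
  by congr ((r ^+ _) u); lia.
by congr ((r ^+ _) u); lia.
Qed.

Lemma walk_endpoints u : s u = u -> endpoints (walk u) = [set u; opposite u].
Proof.
move=> su; have d0 := d_gt0 u; have dE := d_even su.
(* As [d u] is even, the last position [d u - 1] is odd and its exponent is exactly half of
   [d u]. *)
rewrite (endpointsE u) size_mkseq // !nth_mkseq ?ltn_predL //= expg0 perm1.
rewrite /opposite /walk_exp; congr [set _; (r ^+ _) u].
case: ifP; lia.
Qed.

End TwoInvolutions.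

(** * Matchings and inverse-closed paths in the power graph *)

Section Ubar.
Local Open Scope group_scope.
Variable gT : finGroupType.

Lemma mem_Ubar (x : gT) : (x \in Ubar gT) = (x^-1 == x).
Proof.
rewrite !inE eq_invg_mul -[x * x]/(x ^+ 2) -order_dvdn dvdn_divisors //.
by rewrite -order_eq1 inE mem_seq1.
Qed.

Lemma card_Ubar (k : nat) : 0 < k -> #|involutions gT| = (2 * k - 1)%N ->
  #|Ubar gT| = (2 * k)%N.
Proof. by move=> k_gt0 card_inv; rewrite cardsU1 card_inv !inE order1 /=; lia. Qed.

Lemma power_adjV (x : gT) : x \notin Ubar gT -> power_adj x x^-1.
Proof. by rewrite mem_Ubar /power_adj eq_sym cycleV cycle_id => ->. Qed.

Lemma matching_paths (k : nat) (m : gT -> gT) : #|Ubar gT| = (2 * k)%N ->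
    @matching_involution (power_graph gT) m ->
  exists P : 'I_k -> seq gT,
    [/\ forall i, is_path (power_graph gT) (P i),
        forall i, inverse_closed (P i),
        forall i j, i != j -> [disjoint P i & P j]
      & \bigcup_(i < k) endpoints (P i) = Ubar gT].
Proof.
move=> cardU [mK m_adj].
have m_free x : m x != x.
  by apply/eqP=> mx; have := m_adj x; rewrite mx adj_irrefl.
have sK : involutive (@invg gT) := @invgK gT.
have fixU x : x \in Ubar gT -> x^-1 = x by rewrite mem_Ubar => /eqP.
pose w := opposite sK mK.
have wU : {in Ubar gT, forall x, w x \in Ubar gT}.
  by move=> x /fixU Ux; rewrite mem_Ubar (opposite_fixed sK mK m_free Ux).
have wK : {in Ubar gT, cancel w w} by move=> x /fixU; apply: oppositeK.
have w_free : {in Ubar gT, forall x, w x != x}.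
  by move=> x /fixU; apply: opposite_free.
(* [R] takes one element from each pair [{x, w x}] in [Ubar gT]; these are the [k] starting
   points. *)
have [R [RU wR wnR cardR]] := free_involution_half wU wK w_free.
have {cardR} cardR : k = #|R| by apply/eqP; rewrite -(eqn_pmul2l (isT : 0 < 2)) -cardU cardR.
pose u (i : 'I_k) : gT := enum_val (cast_ord cardR i).
have uR i : u i \in R := enum_valP _.
have su i : (u i)^-1 = u i by apply/fixU/(subsetP RU).
exists (fun i => walk sK mK (u i)); split=> [i|i|i j|].
- apply/and3P; split; last exact: walk_uniq.
    by rewrite -size_eq0 size_mkseq -lt0n; apply/card_gt0P; exists (u i); apply: porbit_id.
  apply/(sortedP (1 : gT)) => a lt_a.
  (* Consecutive vertices of a walk differ, so an inversion step never starts in [Ubar gT]. *)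
  have := nth_uniq 1 (ltnW lt_a) lt_a (walk_uniq sK mK (u i)).
  rewrite (walk_step _ (su i) lt_a); set y := nth _ _ _.
  case: ifP => _ neq_y; last exact: m_adj.
  by apply: power_adjV; rewrite mem_Ubar eq_sym neq_y; lia.
- apply/setP=> x; rewrite inE mem_walk; apply/idP/imsetP => [x_i | [y + ->]].
    by exists x^-1; rewrite ?invgK // mem_walk porbit_stable.
  by rewrite mem_walk; apply: porbit_stable.
- apply: contraR => /pred0Pn[x /=]; rewrite !mem_walk => /andP[x_i x_j].
  (* A common vertex forces a common orbit; then [u j] is [u i] or [w (u i)], and the choice of [R]
     excludes the second. *)
  have : u j \in porbit (two_involutions_perm sK mK) (u i).
    by rewrite -eq_porbit_mem; move: x_i x_j; rewrite -!eq_porbit_mem => /eqP <- /eqP <-.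
  case/(fixed_porbit (su i) (su j)) => [/enum_val_inj/cast_ord_inj-> // | uj].
  by have := wR _ (uR i); rewrite /w -uj uR.
- apply/setP=> x; apply/bigcupP/idP => [[i _] | Ux].
    rewrite walk_endpoints // => /set2P[] ->; last apply: wU; exact: (subsetP RU).
  have [Rx|nRx] := boolP (x \in R).
    exists (cast_ord (esym cardR) (enum_rank_in Rx x)) => //.
    by rewrite walk_endpoints // /u cast_ordKV enum_rankK_in // set21.
  (* A point outside [R] is the final endpoint of the walk that starts at [w x]. *)
  have Rwx := wnR x Ux nRx.
  exists (cast_ord (esym cardR) (enum_rank_in Rwx (w x))) => //.
  by rewrite walk_endpoints // /u cast_ordKV enum_rankK_in // -/(w (w x)) wK // set22.
Qed.

Lemma paths_matching (k : nat) (P : 'I_k -> seq gT) : #|Ubar gT| = (2 * k)%N ->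
    (forall i, is_path (power_graph gT) (P i)) ->
    (forall i, inverse_closed (P i)) ->
    (forall i j, i != j -> [disjoint P i & P j]) ->
    \bigcup_(i < k) endpoints (P i) = Ubar gT ->
  exists m : power_graph gT -> power_graph gT, matching_involution m.
Proof.
move=> cardU pathP invP disjP endP.
have size_gt0 i : 0 < size (P i) by case/and3P: (pathP i); case: (P i).
have uniqP i : uniq (P i) by case/and3P: (pathP i).
have same i j x : x \in P i -> x \in P j -> i = j.
  move=> xi xj; apply/eqP; apply: contraTT (xj) => /disjP.
  by move/disjointFr->.
have end_sub i : {subset endpoints (P i) <= P i}.
  move=> x; rewrite (endpointsE x) // => /set2P[] ->; rewrite mem_nth //.
  by rewrite ltn_predL.
(* The [k] endpoint sets have at most 2 elements each and together cover [2 * k] elements, so none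
   can have fewer than 2. *)
have card_end i : #|endpoints (P i)| = 2.
  have le2 j : #|endpoints (P j)| <= 2.
    by rewrite (endpointsE 1) // cards2; case: eqP.
  have : #|Ubar gT| <= \sum_(j < k) #|endpoints (P j)|.
    rewrite -endP; apply: (big_rec2 (fun (A : {set gT}) b => #|A| <= b)); first by rewrite cards0.
    by move=> j A b _ le_b; rewrite (leq_trans (leq_card_setU _ _)) // leq_add2l.
  rewrite cardU (bigD1 i) //= => le_sum.
  have : \sum_(j < k | j != i) #|endpoints (P j)| <= 2 * (k - 1).
    have -> : (2 * (k - 1) = \sum_(j < k | j != i) 2)%N.
      by rewrite sum_nat_const cardC1 card_ord mulnC subn1.
    exact: leq_sum.
  move=> le_S; apply/eqP; rewrite eqn_leq le2 /= -(leq_add2r (2 * (k - 1))).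
  have -> : (2 + 2 * (k - 1) = 2 * k)%N by have := ltn_ord i; lia.
  by apply: leq_trans le_sum _; rewrite leq_add2l.
(* By disjointness, an element of [Ubar gT] on [P i] can only be an endpoint of [P i] itself. *)
have PU i : [set x in P i] :&: Ubar gT = endpoints (P i).
  apply/setP=> x; rewrite -endP inE inE; apply/andP/idP=> [[xi /bigcupP[j _ xj]] | xi].
    by rewrite (same _ _ _ xi (end_sub _ _ xj)).
  by split; [apply: end_sub | apply/bigcupP; exists i].
(* Two vertices lie in [Ubar gT], and inversion pairs off the others. *)
have even_size i : ~~ odd (size (P i)).
  have -> : size (P i) = #|[set x in P i]| by rewrite cardsE; apply/esym/card_uniqP.
  rewrite -(cardsID (Ubar gT)) PU card_end.
  have [|||R [_ _ _ ->]] := @free_involution_half gT ([set x in P i] :\: Ubar gT) invg.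
  - move=> x /setDP[xi]; rewrite !in_setD !mem_Ubar invgK eq_sym => -> /=.
    by rewrite invP imset_f //; move: xi; rewrite inE.
  - by move=> x _; apply: invgK.
  - by move=> x /setDP[_]; rewrite mem_Ubar.
  by rewrite mul2n oddD odd_double.
(* Exchanges the positions [2b] and [2b+1]. *)
pose flip a := if odd a then a.-1 else a.+1.
(* Even length leaves no last position without a partner. *)
have flip_lt i a : a < size (P i) -> flip a < size (P i).
  by rewrite /flip; have := even_size i; case: ifP; lia.
have flipK : involutive flip by move=> a; rewrite /flip; do 2 case: ifP; lia.
(* The default [1] is never read, since [flip_lt] keeps the flipped index in range. *)
pose m x := if [pick i | x \in P i] is Some i then nth 1 (P i) (flip (index x (P i))) else x^-1.
have mE i x : x \in P i -> m x = nth 1 (P i) (flip (index x (P i))).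
  move=> xi; rewrite /m; case: pickP => [j xj | /(_ i)]; last by rewrite xi.
  by rewrite (same _ _ _ xi xj).
have mV x : (forall i, x \notin P i) -> m x = x^-1.
  by move=> xP; rewrite /m; case: pickP => // i; rewrite (negbTE (xP i)).
have cases x : (exists i, x \in P i) \/ (forall i, x \notin P i).
  case: (pickP (fun i => x \in P i)) => [i xi | xP]; first by left; exists i.
  by right=> i; rewrite xP.
exists m; split=> x; case: (cases x) => [[i xi] | xP].
- have lt_x : index x (P i) < size (P i) by rewrite index_mem.
  have mxi : m x \in P i by rewrite (mE i) // mem_nth // flip_lt.
  by rewrite (mE i (m x)) // (mE i x) // index_uniq ?flip_lt // flipK nth_index.
- rewrite (mV x) // mV ?invgK // => i; apply: contra (xP i) => xVi.
  have : x^-1 \in [set x in P i] by rewrite inE.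
  by rewrite invP => /imsetP[y yi /invg_inj->].
- have lt_x : index x (P i) < size (P i) by rewrite index_mem.
  have /and3P[_ /(sortedP (1 : gT)) adjP _] := pathP i.
  have flip_x : flip (index x (P i)) < size (P i) by apply: flip_lt.
  rewrite (mE i) // -{1}(nth_index 1 xi).
  move: (index x (P i)) lt_x flip_x => a lt_a; rewrite /flip.
  case: ifP => odd_a flip_a; last exact: adjP.
  by case: a odd_a lt_a {flip_a} => // a _ lt_a; rewrite adj_sym; apply: adjP.
(* All of [Ubar gT] lies on the paths, so an [x] off the paths differs from its inverse. *)
- rewrite mV //; apply: power_adjV; rewrite -endP; apply/bigcupP=> -[i _].
  by move/end_sub; apply/negP.
Qed.

End Ubar.

Theorem theorem4p4 (n k : nat) (hn : 0 < n) (hk : 0 < k) (gT : finGroupType)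
    (hG : #|gT| = 2 * n) (hinv : #|involutions gT| = 2 * k - 1) :
  [<-> optimal (nK2 n) gT;
       has_perfect_matching (power_graph gT);
       exists P : 'I_k -> seq gT,
         [/\ forall i, is_path (power_graph gT) (P i),
             forall i, inverse_closed (P i),
             forall i j, i != j -> [disjoint P i & P j]
           & \bigcup_(i < k) endpoints (P i) = Ubar gT]].
Proof.
have cardU := card_Ubar hk hinv.
tfae.
- by move/(optimal_nK2_matching hG)/matching_involutionP.
- by case/matching_involutionP=> m; apply: matching_paths.
- by case=> P [*]; apply/(optimal_nK2_matching hG)/(paths_matching cardU).
Qed.
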